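(* Let $X_f$ be an $f$-spindle (not necessarily finite), with $X=X_0\sqcup\{b\}$, $f\colon X_0\to X_0$, and one chosen vertex $v^i$ from each connected component of $\Gamma_f$. Then the first homology group $H_1(X_f)$ is the abelian group generated by (the classes of) (1) the pairs $(f(y),y)$, one for each initial element $y\in X_0$; (2) the pairs $(v^i,b)$ and the pairs $(v^i,y)$, where $y\in X_0$ is not in the same orbit as $v^i$; (3) the sums $(b,c_1)+\dots+(b,c_k)$, one for each cycle $(c_1,\dots,c_k)$ in $\Gamma_f$; subject only to the relations $\ell\cdot(f(y),y)\equiv 0$ for the generators in (1). In particular, if $X$ is a finite set, then $$H_1(X_f)\cong\mathbb{Z}^{|X_0|(\mathrm{orb}(f)-1)+2\,\mathrm{orb}(f)}\oplus\mathbb{Z}_\ell^{\mathrm{init}(f)}.$$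
   Context: A spindle $(X,\star)$ is a set with a binary operation that is idempotent ($x\star x=x$) and self-distributive ($(x\star y)\star z=(x\star z)\star(y\star z)$). Its one-term distributive chain complex $C(X)$ has $C_n(X)=\mathbb{Z}X^{n+1}$, the free abelian group on sequences $(x_0,\dots,x_n)$ ($n\geqslant 0$), with $\partial_n=\sum_{i=0}^n(-1)^id^i$ where $d^0(x_0,\dots,x_n)=(x_1,\dots,x_n)$ and $d^i(x_0,\dots,x_n)=(x_0\star x_i,\dots,x_{i-1}\star x_i,x_{i+1},\dots,x_n)$ for $i\geqslant1$; the differential vanishes on $C_0(X)$. $H_n(X)$ denotes its homology. $f$-spindle: given a set $X$ with basepoint $b$, $X_0=X\setminus\{b\}$, and a function $f\colon X_0\to X_0$, the $f$-spindle $X_f$ is $X$ with the operation $b\star y=f(y)$ for $y\in X_0$, and $x\star y=y$ in all other cases (so $b\star b=b$). Let $\Gamma_f$ be the directed graph with vertex set $X_0$ and an edge $x\to f(x)$ for each $x\in X_0$. The orbits of $f$ are (the vertex sets of) the connected components of $\Gamma_f$; $\mathrm{orb}(f)$ is their number. An element of $X_0$ is initial if it is not in the image of $f$; $\mathrm{init}(f)$ is the number of initial elements. Each component contains at most one directed cycle (a fixed point being a cycle of length $1$), and cycles are considered up to cyclic rotation. $\ell$ is the greatest common divisor of the lengths of all cycles of $\Gamma_f$, and $\ell=0$ if there are no cycles. $\mathbb{Z}_\ell=\mathbb{Z}/\ell\mathbb{Z}$. *)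

(* Defs.v *)
From HB Require Import structures.
From Stdlib Require Import Relation_Operators.
From mathcomp Require Import all_boot all_order all_algebra.
From mathcomp Require Import ring_quotient finmap.
From mathcomp Require Import multinomials.freeg.
From mathcomp Require Import boolp classical_sets functions cardinality.

Set Implicit Arguments.
Unset Strict Implicit.
Unset Printing Implicit Defensive.

Import GRing.Theory.

Local Open Scope ring_scope.
Local Open Scope classical_set_scope.

(* Carriers are choiceTypes because [{freeg _}] requires it; classically every
   type is one, so this is no restriction on the underlying sets. *)
Record spindle := Spindle {
  spindle_sort :> choiceType;
  spindle_op : spindle_sort -> spindle_sort -> spindle_sort;
  spindle_idem : forall x, spindle_op x x = x;
  spindle_distr : forall x y z,
    spindle_op (spindle_op x y) z =
    spindle_op (spindle_op x z) (spindle_op y z)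
}.

Section FreeAbelian.
Variables (K : choiceType) (A : zmodType).

(* The homomorphism from the free abelian group on K extending g. *)
Definition free_ext (g : K -> A) : {freeg K} -> A :=
  @fglift int (zmodule A) K g.

Lemma free_ext_is_zmod_morphism g : zmod_morphism (free_ext g).
Proof. exact: (@lift_is_additive int K (zmodule A) g). Qed.

HB.instance Definition _ g := GRing.isZmodMorphism.Build {freeg K} A
  (free_ext g) (free_ext_is_zmod_morphism g).

Lemma free_extU g k : free_ext g << k >> = g k.
Proof. by rewrite /free_ext liftU scale1r. Qed.

End FreeAbelian.

Definition subgroup_generated (A : zmodType) (S : set A) : set A :=
  [set x | forall G : set A, S `<=` G ->
     G 0 -> (forall y z, G y -> G z -> G (y - z)) -> G x].

(* The family g : K -> A generates the abelian group A, and all the relations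
   between its members are consequences of those listed in R. *)
Definition presented_by (K : choiceType) (A : zmodType) (g : K -> A)
    (R : set {freeg K}) : Prop :=
  (forall a : A, exists x, free_ext g x = a) /\
  (forall x, free_ext g x = 0 <-> subgroup_generated R x).

Section Homology.
Variable X : spindle.
Local Notation "x ⋆ y" := (spindle_op x y) (at level 40).

Definition chain (n : nat) : zmodType := {freeg n.+1.-tuple X}.

(* [tnth x (fintype.lift i j)] is x_j for j < i and x_(j+1) for j >= i. *)
Definition face (n : nat) (i : 'I_n.+1) (x : n.+1.-tuple X) : n.-tuple X :=
  [tuple let y := tnth x (fintype.lift i j) in if (j < i)%N then y ⋆ tnth x i else y
     | j < n].

Definition bd (n : nat) : chain n -> chain n.-1 :=
  match n with
  | 0 => fun=> 0
  | m.+1 => free_ext (fun x : m.+2.-tuple X =>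
              \sum_(i < m.+2) (<< face i x >> : chain m) *~ (-1) ^+ i)
  end.

Lemma bd_is_zmod_morphism n : zmod_morphism (@bd n).
Proof. by case: n => [|n] x y; [rewrite subr0 | exact: raddfB]. Qed.

HB.instance Definition _ n := GRing.isZmodMorphism.Build (chain n)
  (chain n.-1) (@bd n) (@bd_is_zmod_morphism n).

Definition ker_bd (n : nat) : {pred chain n} := fun c => bd c == 0.

Lemma ker_bd_zmod_closed n : zmod_closed (@ker_bd n).
Proof.
split=> [|x y]; rewrite !unfold_in /ker_bd ?raddf0 //.
by move=> /eqP hx /eqP hy; rewrite raddfB [X in X - _]hx [X in _ - X]hy subr0.
Qed.

HB.instance Definition _ n := GRing.isZmodClosed.Build (chain n)
  (@ker_bd n) (@ker_bd_zmod_closed n).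

Record chain_cycle (n : nat) := ChainCycle {
  cycle_val :> chain n;
  cycle_valP : cycle_val \in @ker_bd n
}.

HB.instance Definition _ n := [isSub for @cycle_val n].
HB.instance Definition _ n := [Choice of chain_cycle n by <:].
HB.instance Definition _ n := [SubChoice_isSubZmodule of chain_cycle n by <:].

(* The image of bd n.+1, as a subgroup of the n-cycles. *)
Definition boundary (n : nat) : {pred chain_cycle n} :=
  fun z => `[< exists c : chain n.+1, bd c = cycle_val z >].

Lemma boundary_zmod_closed n : zmod_closed (@boundary n).
Proof.
split=> [|x y]; rewrite !unfold_in; first by apply/asboolP; exists 0; rewrite raddf0.
move=> /asboolP[c hc] /asboolP[d hd]; apply/asboolP; exists (c - d).
by rewrite raddfB; congr (_ - _); [exact: hc | exact: hd].
Qed.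

HB.instance Definition _ n := GRing.isZmodClosed.Build (chain_cycle n)
  (@boundary n) (@boundary_zmod_closed n).

Definition homology (n : nat) : zmodType :=
  {ideal_quot (@boundary n : {pred chain_cycle n})}.

Definition homology_class (n : nat) (z : chain_cycle n) : homology n :=
  (\pi_(homology n) z)%qT.

End Homology.

Definition is_gcd (S : set nat) (d : nat) : Prop :=
  forall e, (e %| d)%N <-> (forall k, S k -> (e %| k)%N).

Definition gcd_set (S : set nat) : nat := xget 0%N (is_gcd S).

Lemma gcd_setP S : is_gcd S (gcd_set S).
Proof.
suff [d hd] : exists d, is_gcd S d by exact: xgetPex (ex_intro _ d hd).
pose comb d := exists2 s : seq nat, (forall k, k \in s -> S k) &
  d = foldr gcdn 0%N s.
have combE d e : comb d -> (forall k, S k -> (e %| k)%N) -> (e %| d)%N.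
  move=> [s hs ->] he; elim: s hs => [|k s IHs] hs; first exact: dvdn0.
  rewrite /= dvdn_gcd; apply/andP; split; first exact/he/hs/mem_head.
  by apply: IHs => j js; apply: hs; rewrite inE js orbT.
have combS k d : S k -> comb d -> comb (gcdn k d).
  move=> Sk [s hs ->]; exists (k :: s) => // j.
  by rewrite inE => /predU1P[->|/hs].
have [ex|noex] := pselect (exists d, `[< comb d >] && (0 < d)%N); last first.
  exists 0%N => e; split=> [_ k Sk|//].
  suff -> : k = 0%N by exact: dvdn0.
  apply/eqP; apply: contra_notT noex; rewrite -lt0n => k_gt0; exists k.
  rewrite k_gt0 andbT; apply/asboolP; exists [:: k]; last by rewrite /= gcdn0.
  by move=> j; rewrite inE => /eqP ->.
case: (ex_minnP ex) => d /andP[/asboolP cd d_gt0] dmin; exists d => e.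
split=> [ed k Sk|]; last exact: combE.
apply: (dvdn_trans ed); suff /eqP -> : d == gcdn k d by exact: dvdn_gcdl.
rewrite eqn_leq (dvdn_leq d_gt0 (dvdn_gcdr k d)) andbT; apply: dmin.
by rewrite gcdn_gt0 d_gt0 orbT andbT; apply/asboolP; exact: combS.
Qed.

(* Only meaningful when A is finite. *)
Definition num (T : choiceType) (A : set T) : nat := #|` fset_set A|%fset.

Section FSpindle.
Variables (X0 : choiceType) (f : X0 -> X0).

(* X is X0 together with the basepoint b = None. *)
Definition fop (x y : option X0) : option X0 :=
  if (x, y) is (None, Some y') then Some (f y') else y.

Lemma fop_idem x : fop x x = x.
Proof. by case: x. Qed.

Lemma fop_distr x y z : fop (fop x y) z = fop (fop x z) (fop y z).
Proof. by case: x y z => [x|] [y|] [z|]. Qed.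

Definition fspindle : spindle := Spindle fop_idem fop_distr.

Definition edge (x y : X0) : Prop := y = f x.

Definition same_orbit : X0 -> X0 -> Prop := clos_refl_sym_trans X0 edge.

Definition orbits : set (set X0) := [set same_orbit x | x in setT].

Definition initial : set X0 := ~` range f.

(* Directed cycles, as lists of vertices with a chosen starting vertex. *)
Definition graph_cycle : set (seq X0) :=
  [set c | [/\ c != [::], uniq c & fcycle f c]].

Definition ell : nat := gcd_set [set size c | c in graph_cycle].

Definition orb : nat := num orbits.
Definition init : nat := num initial.

Definition chain_pair (x y : option X0) : chain fspindle 1 :=
  << [tuple x; y] : 2.-tuple fspindle >>.

Definition gens1 : set (chain fspindle 1) :=
  [set chain_pair (Some (f y)) (Some y) | y in initial].

Variable V : set X0.

Definition gens2 : set (chain fspindle 1) :=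
  [set chain_pair (Some v) None | v in V] `|`
  [set c | exists v y, [/\ V v, ~ same_orbit v y & c = chain_pair (Some v) (Some y)]].

(* The sum does not depend on the starting vertex, so that each directed cycle
   up to rotation contributes one generator. *)
Definition gens3 : set (chain fspindle 1) :=
  [set \sum_(x <- c) chain_pair None (Some x) | c in graph_cycle].

Definition gens : set (chain fspindle 1) := gens1 `|` gens2 `|` gens3.

Lemma bd_chain_pair x y : bd (chain_pair x y) =
  << [tuple y] : 1.-tuple fspindle >> - << [tuple fop x y] : 1.-tuple fspindle >>.
Proof.
rewrite /bd /chain_pair free_extU big_ord_recl big_ord1 expr0 expr1 mulr1z mulrNz mulr1z.
by congr (<< _ >> - << _ >>); apply: eq_from_tnth => i; rewrite !ord1 !(tnth_mktuple, tnth0);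
  rewrite /= !(tnth_nth None).
Qed.

Lemma gens_cycle (c : chain fspindle 1) : gens c -> c \in @ker_bd fspindle 1.
Proof.
rewrite unfold_in /ker_bd => -[[[y _ <-]|[[v _ <-]|[v [y [_ _ ->]]]]]|[s]];
  rewrite ?bd_chain_pair ?subrr //.
case=> _ _ fs <-; rewrite raddf_sum /=.
rewrite (eq_bigr _ (fun x _ => bd_chain_pair None (Some x))) /=.
rewrite sumrB subr_eq0; apply/eqP.
rewrite -(big_map f xpredT (fun x => << [tuple Some x] : 1.-tuple fspindle >>)).
apply: perm_big.
suff -> : [seq f x | x <- s] = rot 1 s by rewrite perm_sym perm_rot.
case: s fs => [|x s] //; rewrite rot1_cons /=.
suff H z : path (frel f) z (rcons s x) -> [seq f y | y <- z :: s] = rcons s x.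
  exact: H.
elim: s z => [|y s IHs] z /=; first by rewrite andbT => /eqP ->.
by case/andP=> /eqP -> /IHs /= ->.
Qed.

Definition gen_cycle (g : gens) : chain_cycle fspindle 1 :=
  ChainCycle (gens_cycle (set_mem (valP g))).

Definition gen_rels : set {freeg gens} :=
  [set << g >> *+ ell | g in [set g : gens | gens1 (val g)]].

Definition one_per_orbit : Prop :=
  forall x, exists! v, V v /\ same_orbit x v.

End FSpindle.

Arguments gens1 {X0} f _.
Arguments gens2 {X0} f V _.
Arguments gens3 {X0} f _.
Arguments gens {X0} f V _.
Arguments gen_rels {X0} f V _.

(* Z/lZ for every l, including l = 0 and l = 1, which ['Z_l] does not cover. *)
Definition Zmod (l : nat) : zmodType := {ideal_quot (dvdz l : {pred int})}.

Definition isomorphic (A B : zmodType) : Prop :=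
  exists phi : {additive A -> B}, bijective phi.

(* Main.v *)
From HB Require Import structures.
Require Import Defs.
From Stdlib Require Import Relation_Operators.
From mathcomp Require Import all_boot all_order all_algebra.
From mathcomp Require Import ring_quotient finmap.
From mathcomp Require Import multinomials.freeg.
From mathcomp Require Import boolp classical_sets functions cardinality.
From mathcomp Require Import zify ring.

(** In degree 2 the boundary of a triple (x, y, z) depends only on where the
basepoint b sits in it. Sorting the cases, the group of 1-boundaries is spanned
by (z, z), (z, f z), (y, b) - (f y, b) and
(y, z) - (f y, z) + (f z, z), where y and z are not b except in (z, z). So
modulo boundaries the first entry y of a pair may be moved along an edge of
the graph: for free if the second entry is b, at the cost of the tail
t_z = (f z, z) otherwise. If z is not initial, say z = f x, then t_z vanishes,
because (x, z) and (z, z) both do. If z is initial, walking once around a cycle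
of length k gives k t_z = 0, hence l t_z = 0 for the gcd l of the cycle lengths
([bounds_ell]).

Every pair other than (b, y) is a cycle, and moving its first entry to the
representative of its orbit writes it in terms of the generators. What remains
of a cycle is a combination of pairs (b, y) whose coefficients form a finite
chain of vertices fixed by f; by pigeonhole such a chain is a combination of
directed cycles ([invariant_cycle_sums]). Hence the listed classes generate
([spanned_cycle]).

That there are no other relations is shown by duality. Every generator has an
integer-valued cochain that kills the boundaries and takes the value 1 on it
and 0 on the other generators, exactly for the generators of types (2) and (3),
and modulo l for those of type (1) ([gens_dual]). For (v, z) it counts the pairs
(x, z) with x in the orbit of v. For a cycle it counts the pairs (b, c) with c a
fixed vertex of the cycle. For t_y it is the height of x relative to y on the
pairs (x, y), where a height increases by 1 along each edge; heights exist only
modulo l ([height_exists]). So a combination of generators is a boundary iff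
its coefficients at the generators of type (1) are divisible by l and the
others are 0 ([gen_class_kernel]), which is the presentation.

If X is finite, each orbit contains exactly one cycle, and counting the
generators of each type turns the presentation into the stated sum
([homology_finite]). *)

Set Implicit Arguments.
Unset Strict Implicit.
Unset Printing Implicit Defensive.

Import GRing.Theory Num.Theory.

Local Open Scope ring_scope.
Local Open Scope classical_set_scope.

(** * Subgroups and free abelian groups *)

(** The propositional counterpart of [zmod_closed], so that it applies to
subsets that are not given by a boolean predicate. *)
Definition is_subgroup (A : zmodType) (G : set A) : Prop :=
  G 0 /\ forall y z, G y -> G z -> G (y - z).

Section Subgroups.
Variables (A : zmodType) (G : set A).
Hypothesis sG : is_subgroup G.

Lemma subgroup0 : G 0. Proof. by case: sG. Qed.

Lemma subgroupB y z : G y -> G z -> G (y - z).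
Proof. by case: sG => _; apply. Qed.

Lemma subgroupN y : G y -> G (- y).
Proof. by move=> Gy; rewrite -[- y]add0r; apply: subgroupB => //; exact: subgroup0. Qed.

Lemma subgroupD y z : G y -> G z -> G (y + z).
Proof. by move=> Gy Gz; rewrite -[z]opprK; apply: subgroupB => //; exact: subgroupN. Qed.

Lemma subgroupBl y z : G y -> G (y - z) <-> G z.
Proof.
move=> Gy; split=> [Gyz|]; last exact: subgroupB.
by have := subgroupB Gy Gyz; rewrite subKr.
Qed.

Lemma subgroup_iff y z : G (y - z) -> G y <-> G z.
Proof.
move=> Gyz; split=> [Gy|Gz]; first exact/(subgroupBl _ Gy).
by rewrite -(subrK z y); apply: subgroupD.
Qed.

Lemma subgroupMn y n : G y -> G (y *+ n).
Proof.
by move=> Gy; elim: n => [|n IHn]; [exact: subgroup0 | rewrite mulrS; exact: subgroupD].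
Qed.

Lemma subgroupMz y (n : int) : G y -> G (y *~ n).
Proof.
by case: n => n Gy; [|apply: subgroupN]; exact: subgroupMn.
Qed.

Lemma subgroup_sum (I : eqType) (s : seq I) (F : I -> A) :
  (forall i, i \in s -> G (F i)) -> G (\sum_(i <- s) F i).
Proof.
move=> GF; rewrite big_seq; apply: big_ind => //; first exact: subgroup0.
exact: subgroupD.
Qed.

(** The multiples of a that lie in a subgroup are the multiples of one number,
so they include the gcd as soon as they include every member of S. *)
Lemma subgroup_mulrn_gcd (a : A) (S : set nat) :
  (forall k, S k -> G (a *+ k)) -> G (a *+ gcd_set S).
Proof.
move=> GS; have gS := gcd_setP S.
have [ex|noex] := pselect (exists d, `[< G (a *+ d) >] && (0 < d)%N).
  (* The least positive d with d a in G divides all of S, hence its gcd. *)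
  case: (ex_minnP ex) => d /andP[/asboolP Gd d_gt0] dmin.
  have /(gS d)/dvdnP[q ->] : forall k, S k -> (d %| k)%N.
    move=> k /GS Gk; rewrite /dvdn; apply: contraT; rewrite -lt0n => r_gt0.
    have /dmin : `[< G (a *+ (k %% d)) >] && (0 < k %% d)%N.
      rewrite r_gt0 andbT; apply/asboolP.
      move: Gk; rewrite {1}(divn_eq k d) mulrnDr => Gk.
      rewrite -[_ *+ _](addKr (a *+ (k %/ d * d))); apply: subgroupD => //.
      by apply: subgroupN; rewrite mulnC mulrnA; apply: subgroupMn.
    by rewrite leqNgt ltn_mod d_gt0.
  by rewrite mulnC mulrnA; apply: subgroupMn.
(* Otherwise S contains nothing but 0, and its gcd is 0. *)
suff /(gS 0%N) : forall k, S k -> (0 %| k)%N.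
  by rewrite dvd0n => /eqP ->; rewrite mulr0n; exact: subgroup0.
move=> k /GS Gk; rewrite dvd0n; apply: contra_notT noex; rewrite -lt0n => k_gt0.
by exists k; rewrite k_gt0 andbT; apply/asboolP.
Qed.

End Subgroups.

Section FreeAbelianTheory.
Variable K : choiceType.

Lemma freeg_subgroup_ind (G : set {freeg K}) :
  is_subgroup G -> (forall k, G << k >>) -> forall x, G x.
Proof.
move=> sG GU x; rewrite -(freeg_sumE x); apply: subgroup_sum => // k _.
by rewrite -[coeff k x]intz -freegU_mulz; apply: subgroupMz.
Qed.

Lemma free_ext_comp (A B : zmodType) (h : {additive A -> B}) (g : K -> A) x :
  h (free_ext g x) = free_ext (fun k => h (g k)) x.
Proof.
move: x; apply: freeg_subgroup_ind => [|k]; last by rewrite !free_extU.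
by split=> [|x y hx hy]; rewrite ?raddf0 // !raddfB hx hy.
Qed.

(** Values of a homomorphism on basis elements that are dual to k modulo m make
it compute the coefficient of k modulo m. This is how the absence of further
relations is detected. *)
Lemma dvdz_coeff (g : K -> int) k m :
  (forall j, (m %| g j - (j == k)%:R)%Z) ->
  forall x : {freeg K}, (m %| free_ext g x - coeff k x)%Z.
Proof.
move=> gk; apply: (@freeg_subgroup_ind [set x | (m %| free_ext g x - coeff k x)%Z]).
  split=> [|x y] /=; first by rewrite !raddf0 dvdz0.
  move=> hx hy; rewrite raddfB coeffB opprD addrACA -opprD; exact: rpredB.
by move=> j /=; rewrite free_extU coeffU mul1r.
Qed.

End FreeAbelianTheory.

(** Both A and B are the quotient of F by the common kernel. *)
Lemma isomorphic_same_kernel (F A B : zmodType) (q : {additive F -> A})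
    (r : {additive F -> B}) :
  (forall a, exists x, q x = a) -> (forall b, exists x, r x = b) ->
  (forall x, q x = 0 <-> r x = 0) -> isomorphic A B.
Proof.
move=> qsurj rsurj qr; have [s qs] := choice qsurj; have [t rt] := choice rsurj.
have q_r x y : q x = q y -> r x = r y.
  by move=> e; apply/eqP; rewrite -subr_eq0 -raddfB; apply/eqP/qr; rewrite raddfB e subrr.
have r_q x y : r x = r y -> q x = q y.
  by move=> e; apply/eqP; rewrite -subr_eq0 -raddfB; apply/eqP/qr; rewrite raddfB e subrr.
have phiB : zmod_morphism (fun a => r (s a)).
  by move=> a b; rewrite -raddfB; apply: q_r; rewrite raddfB !qs.
pose m := GRing.isZmodMorphism.Build A B (fun a => r (s a)) phiB.
pose phi : {additive A -> B} := HB.pack (fun a => r (s a)) m.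
exists phi; exists (fun b => q (t b)) => [a|b] /=.
  by rewrite -[RHS]qs; apply: r_q; rewrite rt.
by rewrite -[RHS]rt; apply: q_r; rewrite qs.
Qed.

Lemma Zmod_eq0 (l : nat) (n : int) : ((\pi_(Zmod l) n)%qT == 0) = (l %| n)%Z.
Proof. by rewrite -(raddf0 (\pi_(Zmod l))%qT) -Quotient.idealrBE subr0. Qed.

(** A group presented by generators k of order [order k], without any other
relation, is the sum of the corresponding cyclic groups. Here e enumerates the
generators of infinite order and d those of order l; the enumerations are
disjoint by hypothesis, since l = 0 is possible. *)
Lemma isomorphic_coeff_quotient (K : choiceType) (A : zmodType)
    (q : {additive {freeg K} -> A}) (order : K -> nat) (l m n : nat)
    (e : 'I_m -> K) (d : 'I_n -> K) :
  (forall a, exists x, q x = a) ->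
  (forall x, q x = 0 <-> forall k, (order k %| coeff k x)%Z) ->
  injective e -> injective d -> (forall i j, e i != d j) ->
  (forall k, (exists i, k = e i) \/ (exists j, k = d j)) ->
  (forall i, order (e i) = 0%N) -> (forall j, order (d j) = l) ->
  isomorphic A ('rV[int]_m * 'rV[Zmod l]_n)%type.
Proof.
move=> qsurj qker einj dinj ed cover oe od.
pose r (x : {freeg K}) : 'rV[int]_m * 'rV[Zmod l]_n :=
  (\row_i coeff (e i) x, \row_j (\pi_(Zmod l) (coeff (d j) x))%qT).
have rB : zmod_morphism r.
  move=> x y; congr pair; apply/rowP => i; rewrite !mxE coeffB //.
  by rewrite raddfB.
pose mr := GRing.isZmodMorphism.Build {freeg K} ('rV[int]_m * 'rV[Zmod l]_n)%type r rB.
pose ra : {additive {freeg K} -> 'rV[int]_m * 'rV[Zmod l]_n} := HB.pack r mr.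
apply: (isomorphic_same_kernel (q := q) (r := ra)) => // [[a b]|x].
  pose u := \sum_i << a 0 i *g e i >>; pose v := \sum_j << repr (b 0 j) *g d j >>.
  exists (u + v); rewrite /= /r; congr pair; apply/rowP => i; rewrite !mxE coeffD !raddf_sum /=.
    rewrite (bigD1 i) //= coeffU eqxx mulr1 !big1 ?addr0 // => j.
      by rewrite coeffU eq_sym (negbTE (ed _ _)) mulr0.
    by rewrite coeffU (inj_eq einj) => /negbTE ->; rewrite mulr0.
  rewrite [X in _ + X](bigD1 i) //= coeffU eqxx mulr1 !big1 ?addr0 ?add0r ?reprK // => j.
    by rewrite coeffU (inj_eq dinj) => /negbTE ->; rewrite mulr0.
  by rewrite coeffU (negbTE (ed _ _)) mulr0.
rewrite qker /= /r; split=> [h|[h1 h2] k].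
  congr pair; apply/rowP => i; rewrite !mxE.
    by have := h (e i); rewrite oe dvd0z => /eqP.
  by have := h (d i); rewrite od -Zmod_eq0 => /eqP.
case: (cover k) => [[i ->]|[j ->]].
  by have := congr1 (fun w : 'rV_m => w 0 i) h1; rewrite !mxE oe dvd0z => ->.
by have := congr1 (fun w : 'rV_n => w 0 j) h2; rewrite !mxE od -Zmod_eq0 => ->.
Qed.

Lemma num_seq (T : choiceType) (A : set T) (s : seq T) :
  uniq s -> (forall x, x \in s <-> A x) -> num A = size s.
Proof.
move=> us sA; have -> : A = [set` seq_fset tt s].
  by apply/seteqP; split=> x; rewrite /mkset seq_fsetE => /sA.
by rewrite /num set_fsetK size_seq_fset undup_id.
Qed.

(** * The graph of f *)

Section FSpindleHomology.
Variables (X0 : choiceType) (f : X0 -> X0).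
Local Notation same_orbit := (same_orbit f).

Lemma same_orbit_refl x : same_orbit x x.
Proof. exact: rst_refl. Qed.

Lemma same_orbit_sym x y : same_orbit x y -> same_orbit y x.
Proof. exact: rst_sym. Qed.

Lemma same_orbit_trans x y z : same_orbit x y -> same_orbit y z -> same_orbit x z.
Proof. exact: rst_trans. Qed.

Lemma same_orbit_succ x : same_orbit x (f x).
Proof. exact: rst_step. Qed.

Lemma same_orbit_iter n x : same_orbit x (iter n f x).
Proof.
elim: n => [|n IHn]; first exact: same_orbit_refl.
exact: same_orbit_trans IHn (same_orbit_succ _).
Qed.

Lemma orbit_invariant (P : X0 -> Prop) :
  (forall x, P x <-> P (f x)) -> forall x y, same_orbit x y -> P x <-> P y.
Proof.
move=> Pf x y; elim=> {x y} [x y ->||x y _ [xy yx]|x y z _ [xy yx] _ [yz zy]] //.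
by split=> [/xy /yz|/zy /yx].
Qed.

Lemma same_orbit_succl x y : same_orbit (f x) y <-> same_orbit x y.
Proof.
by split; apply: same_orbit_trans; [|apply: same_orbit_sym]; exact: same_orbit_succ.
Qed.

(** Since each vertex has one outgoing edge, a zigzag of edges can be replaced by
a peak: two vertices are connected iff their forward paths meet. *)
Lemma same_orbitP x y : same_orbit x y <-> exists m n, iter m f x = iter n f y.
Proof.
split=> [|[m [n e]]]; last first.
  apply: same_orbit_trans (same_orbit_iter m x) _; rewrite e.
  exact/same_orbit_sym/same_orbit_iter.
elim=> {x y} [x y ->|x|x y _ [m [n e]]|x y z _ [m [n e]] _ [p [q e']]].
- by exists 1%N, 0%N.
- by exists 0%N, 0%N.
- by exists n, m.
- exists (p + m)%N, (n + q)%N; rewrite iterD e -iterD addnC.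
  by rewrite [RHS]iterD -e' iterD.
Qed.

Lemma fcycle_iter c x n : fcycle f c -> x \in c -> iter n f x \in c.
Proof.
move=> fc xc; elim: n => [|n IHn] //=.
by have /eqP -> := next_cycle fc IHn; rewrite mem_next.
Qed.

Lemma fcycle_reach c x y :
  fcycle f c -> x \in c -> y \in c -> exists n, y = iter n f x.
Proof.
move=> fc xc; case/rot_to: (xc) => i s cE.
have := fc; rewrite -(rot_cycle i) cE /= rcons_path => /andP[/fpathE sE _].
by rewrite -(mem_rot i) cE sE -trajectS => /trajectP[k _ ->]; exists k.
Qed.

(** Cycles through a common vertex agree up to rotation. *)
Lemma graph_cycle_perm c d x :
  graph_cycle f c -> graph_cycle f d -> x \in c -> x \in d -> perm_eq c d.
Proof.
move=> [_ uc fc] [_ ud fd] xc xd; apply: uniq_perm => // y.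
by apply/idP/idP => [/(fcycle_reach fc xc)|/(fcycle_reach fd xd)] [n ->]; exact: fcycle_iter.
Qed.

(** The cycle through x is traced by its least period, which divides every
other period. *)
Lemma periodic_cycle x k : (0 < k)%N -> iter k f x = x ->
  exists c, [/\ graph_cycle f c, x \in c & (size c %| k)%N].
Proof.
move=> k_gt0 xk; have ex : exists n, (0 < n)%N && (iter n f x == x).
  by exists k; rewrite k_gt0 xk eqxx.
case: (ex_minnP ex) => p /andP[p_gt0 /eqP px] pmin.
have iterM q : iter (q * p) f x = x.
  by elim: q => [|q IHq] //; rewrite mulSn iterD IHq.
exists (traject f x p); split; last 2 first.
- by case: p p_gt0 {px pmin iterM} => [|p] //; rewrite mem_head.
- rewrite size_traject /dvdn; apply: contraT; rewrite -lt0n => r_gt0.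
  have /pmin : (0 < k %% p)%N && (iter (k %% p) f x == x).
    by rewrite r_gt0 -{2}xk {2}(divn_eq k p) addnC iterD iterM eqxx.
  by rewrite leqNgt ltn_mod p_gt0.
split; first by case: p p_gt0 {px pmin iterM}.
- case: p p_gt0 px pmin {iterM} => [|p] // _ px pmin.
  rewrite looping_uniq; apply/negP => /trajectP[i ip e].
  have /pmin : (0 < i.+1)%N && (iter i.+1 f x == x).
    by rewrite andTb -[X in _ == X]px; apply/eqP; congr (f _); exact: esym e.
  by rewrite leqNgt ltnS ip.
- case: p p_gt0 px {pmin iterM} => [|p] // _ px.
  by rewrite /= rcons_path fpath_traject last_traject; apply/eqP.
Qed.

(** On a cycle, f acts as a bijection. *)
Lemma fcycle_perm c : graph_cycle f c -> perm_eq [seq f x | x <- c] c.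
Proof.
move=> [_ uc fc]; have sub : {subset c <= [seq f x | x <- c]}.
  move=> y yc; apply/mapP; exists (prev c y); first by rewrite mem_prev.
  have pc : prev c y \in c by rewrite mem_prev.
  by have /eqP -> := next_cycle fc pc; rewrite next_prev.
have sz : (size [seq f x | x <- c] <= size c)%N by rewrite size_map.
have [_ e] := uniq_min_size uc sub sz.
by rewrite perm_sym; apply: uniq_perm => //; exact: leq_size_uniq sub sz.
Qed.

(** A meeting of two forward paths of one vertex closes a loop, whose length is a
multiple of the length of a cycle. This is what makes heights well defined
modulo [ell f]. *)
Lemma collision_ell x a b :
  iter a f x = iter b f x -> (ell f %| a%:Z - b%:Z)%Z.
Proof.
wlog ab : a b / (a < b)%N => [th|] e.
  have [/th|/th|->] := ltngtP a b; first exact; last by rewrite subrr dvdz0.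
  by rewrite -opprB rpredN; apply.
have k_gt0 : (0 < b - a)%N by rewrite subn_gt0.
have [|c [cc _ ck]] := @periodic_cycle (iter a f x) (b - a) k_gt0.
  by rewrite -iterD subnK // ltnW.
rewrite -opprB rpredN subzn ?(ltnW ab) // dvdzE /=; apply: dvdn_trans ck.
have [H _] := gcd_setP [set size c | c in graph_cycle f] (ell f).
by apply: H => //; exists c.
Qed.

(** * Chains of vertices fixed by f *)

Definition pushforward : {freeg X0} -> {freeg X0} := free_ext (fun x => << f x >>).

Lemma pushforward_is_zmod_morphism : zmod_morphism pushforward.
Proof. by move=> x y; exact: raddfB. Qed.

HB.instance Definition _ := GRing.isZmodMorphism.Build {freeg X0} {freeg X0}
  pushforward pushforward_is_zmod_morphism.

Lemma coeff_pushforward u y :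
  coeff y (pushforward u) = \sum_(x <- dom u | f x == y) coeff x u.
Proof.
rewrite -{1}[u]freeg_sumE raddf_sum /= raddf_sum /= [RHS]big_mkcond /=.
apply: eq_bigr => x _; rewrite -[coeff x u]intz -freegU_mulz raddfMz raddfMz /=.
by rewrite /pushforward free_extU coeffU mul1r intz; case: eqP => _; rewrite ?mul0rz // -mulrzr mul1r intz.
Qed.

Definition cycle_sum (c : seq X0) : {freeg X0} := \sum_(x <- c) << x >>.

Lemma pushforward_cycle_sum c : graph_cycle f c -> pushforward (cycle_sum c) = cycle_sum c.
Proof.
move=> /fcycle_perm pc; rewrite raddf_sum /=.
rewrite (eq_bigr (fun x => << f x >>)) => [|x _]; last exact: free_extU.
by rewrite -(big_map f xpredT (fun x => << x >>)); exact: perm_big.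
Qed.

Lemma coeff_cycle_sum c x : uniq c -> coeff x (cycle_sum c) = (x \in c)%:R.
Proof.
move=> uc; rewrite raddf_sum /= -count_uniq_mem // -sum1_count natr_sum [RHS]big_mkcond /=.
by apply: eq_bigr => y _; rewrite coeffU mul1r; case: eqP.
Qed.

Lemma uniq_map_inj s : uniq [seq f x | x <- s] -> {in s &, injective f}.
Proof.
move=> us x y xs ys e; rewrite -(nth_index x xs) -(nth_index x ys); congr nth.
apply/eqP; rewrite -(nth_uniq (f x) _ _ us) ?size_map ?index_mem //.
by rewrite !(nth_map x) ?index_mem // !nth_index // e.
Qed.

(** The support S of a fixed chain u lies in f(S), so by finiteness f permutes S
and u is constant along the cycles it forms there. Subtracting from u a
multiple of one of these cycles leaves a fixed chain of smaller support. *)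
Lemma invariant_cycle_sums (G : set {freeg X0}) : is_subgroup G ->
  (forall c, graph_cycle f c -> G (cycle_sum c)) ->
  forall u, pushforward u = u -> G u.
Proof.
move=> sG Gc u; have [n] := ubnP (size (dom u)); elim: n u => // n IHn u un fu.
have [u0|nz] := eqVneq (dom u) [::].
  by move/eqP: u0; rewrite dom_eq0 => /eqP ->; exact: subgroup0.
have uS := uniq_dom u; set S := dom u in un nz uS.
have sub : {subset S <= [seq f x | x <- S]}.
  move=> y; rewrite mem_dom -{1}fu coeff_pushforward; apply: contraNT => yS.
  rewrite big_seq_cond big1 // => x /andP[xS /eqP fx].
  by case/negP: yS; rewrite -fx map_f.
have sz : (size [seq f x | x <- S] <= size S)%N by rewrite size_map.
have [_ eS] := uniq_min_size uS sub sz.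
have ufS := leq_size_uniq uS sub sz.
have fS x : x \in S -> f x \in S by move=> xS; rewrite eS map_f.
have itS x k : x \in S -> iter k f x \in S by move=> xS; elim: k => //= k /fS.
have coeff_f x : x \in S -> coeff (f x) u = coeff x u.
  move=> xS; rewrite -{1}fu coeff_pushforward -/S big_mkcond (bigD1_seq x) //= eqxx.
  rewrite big_seq_cond big1 ?addr0 // => y /andP[yS /negbTE yx].
  by rewrite (inj_in_eq (uniq_map_inj ufS)) // yx.
have coeff_it x k : x \in S -> coeff (iter k f x) u = coeff x u.
  by move=> xS; elim: k => //= k <-; apply: coeff_f; exact: itS.
have [x xS] : exists x, x \in S.
  by case: (S) nz => // x s _; exists x; exact: mem_head.
have [y [c [yS cc yc]]] : exists y c, [/\ y \in S, graph_cycle f c & y \in c].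
  (* The path from x stays in S, so it runs into a cycle. *)
  have : looping f x (size S).
    apply: contraT; rewrite -looping_uniq => /uniq_leq_size H.
    have : (size (traject f x (size S).+1) <= size S)%N.
      by apply: H => z /trajectP[k _ ->]; exact: itS.
    by rewrite size_traject ltnn.
  case/trajectP=> i iS e; exists (iter i f x).
  have k_gt0 : (0 < size S - i)%N by rewrite subn_gt0.
  have [|c [cc yc _]] := @periodic_cycle (iter i f x) (size S - i) k_gt0.
    by rewrite -iterD subnK // ltnW.
  by exists c; split => //; exact: itS.
have [_ uc fc] := cc.
have cS z : z \in c -> z \in S /\ coeff z u = coeff y u.
  by move=> /(fcycle_reach fc yc)[k ->]; rewrite itS // coeff_it.
set v := cycle_sum c *~ coeff y u.
have Gv : G v by apply: subgroupMz => //; exact: Gc.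
rewrite -(subrK v u); apply: subgroupD => //; apply: IHn; last first.
  by rewrite (raddfB pushforward) /= fu (raddfMz pushforward) /= pushforward_cycle_sum.
rewrite -ltnS; apply: leq_trans un; rewrite ltnS.
have coeffv z : coeff z v = (z \in c)%:R * coeff y u.
  by rewrite raddfMz /= coeff_cycle_sum // -mulrzr intz.
have : {subset y :: dom (u - v) <= S}.
  move=> z; rewrite inE => /predU1P[->//|]; rewrite !mem_dom coeffB coeffv.
  by apply: contraNneq => z0; rewrite z0; case: (boolP (z \in c)) => [/cS[]|_];
    rewrite ?mul0r ?subr0 // mem_dom z0 eqxx.
have : uniq (y :: dom (u - v)).
  by rewrite /= uniq_dom andbT mem_dom negbK coeffB coeffv yc mul1r subrr.
by move=> /uniq_leq_size H /H.
Qed.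

(** * Boundaries of triples *)

Local Notation C1 := (chain (fspindle f) 1).
Local Notation pair := (chain_pair f).

Definition bounds (c : C1) : Prop := exists d : chain (fspindle f) 2, c = bd d.

Lemma bounds_subgroup : is_subgroup bounds.
Proof.
split=> [|y z [d ->] [e ->]]; first by exists 0; rewrite raddf0.
by exists (d - e); rewrite raddfB.
Qed.

Lemma tupleE3 (t : 3.-tuple (option X0)) :
  t = [tuple tnth t ord0; tnth t (inord 1); tnth t (inord 2)].
Proof.
apply: eq_from_tnth => -[[|[|[|//]]] i]; rewrite !(tnth_nth None) /= ?inordK //.
Qed.

Lemma tupleE2 (t : 2.-tuple (option X0)) :
  t = [tuple tnth t ord0; tnth t (inord 1)].
Proof.
by apply: eq_from_tnth => -[[|[|//]] i]; rewrite !(tnth_nth None) /= ?inordK.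
Qed.

Lemma bd_triple x y z :
  bd (<< [tuple x; y; z] : 3.-tuple (fspindle f) >> : chain (fspindle f) 2) =
  pair y z - pair (fop f x y) z + pair (fop f x z) (fop f y z).
Proof.
rewrite /bd free_extU !big_ord_recl big_ord0 addr0.
rewrite (_ : (-1 : int) ^+ _ = 1) // (_ : (-1 : int) ^+ _ = -1) // (_ : (-1 : int) ^+ _ = 1) //.
rewrite mulrNz !mulr1z addrA.
by congr (<< _ >> - << _ >> + << _ >>); apply: eq_from_tnth => i;
  rewrite tnth_mktuple !(tnth_nth None); case: i => -[|[|]].
Qed.

Lemma bounds_diag z : bounds (pair z z).
Proof.
exists (<< [tuple z; z; z] : 3.-tuple (fspindle f) >>); rewrite bd_triple.
by rewrite fop_idem subrr add0r.
Qed.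

Lemma bounds_edge z : bounds (pair (Some z) (Some (f z))).
Proof.
exists (<< [tuple Some z; None; Some z] : 3.-tuple (fspindle f) >>).
by rewrite bd_triple /= /fop /= subrr add0r.
Qed.

Lemma bounds_base_step y : bounds (pair (Some y) None - pair (Some (f y)) None).
Proof.
apply/(subgroup_iff bounds_subgroup _ (z := pair (Some y) None - pair (Some (f y)) None + pair None None)).
  by rewrite opprD addrA subrr sub0r; apply: subgroupN; [exact: bounds_subgroup|exact: bounds_diag].
by exists (<< [tuple None; Some y; None] : 3.-tuple (fspindle f) >>); rewrite bd_triple.
Qed.

Lemma bounds_step y z : bounds (pair (Some y) (Some z) - pair (Some (f y)) (Some z)
  + pair (Some (f z)) (Some z)).
Proof.
by exists (<< [tuple None; Some y; Some z] : 3.-tuple (fspindle f) >>); rewrite bd_triple.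
Qed.

(** Walking n steps from y costs n tails. *)
Lemma bounds_iter n y z : bounds (pair (Some y) (Some z) - pair (Some (iter n f y)) (Some z)
  + pair (Some (f z)) (Some z) *+ n).
Proof.
have sb := bounds_subgroup.
elim: n => [|n IHn] /=; first by rewrite subrr add0r; exact: subgroup0.
have := subgroupD sb IHn (bounds_step (iter n f y) z).
by rewrite mulrSr addrACA subrKA.
Qed.

(** Walking around a cycle of length k returns to the start at the cost of k
tails, so k tails bound for every cycle length k. *)
Lemma bounds_ell z : bounds (pair (Some (f z)) (Some z) *+ ell f).
Proof.
have sb := bounds_subgroup; apply: subgroup_mulrn_gcd => //.
move=> _ [c [c0 _ fc] <-]; case: c c0 fc => [//|x c] _ fc.
have := bounds_iter (size (x :: c)) x z.
have : iter (size (x :: c)) f x = x.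
  move: fc; rewrite /= rcons_path => /andP[/fpathE -> /eqP].
  by rewrite size_traject last_traject.
by move=> ->; rewrite subrr add0r.
Qed.

Definition cochain (w : option X0 -> option X0 -> int) : C1 -> int :=
  free_ext (fun t : 2.-tuple (fspindle f) => w (tnth t ord0) (tnth t (inord 1))).

Lemma cochain_is_zmod_morphism w : zmod_morphism (cochain w).
Proof. by move=> x y; exact: raddfB. Qed.

HB.instance Definition _ w := GRing.isZmodMorphism.Build C1 int
  (cochain w) (cochain_is_zmod_morphism w).

Lemma cochain_pair w x y : cochain w (pair x y) = w x y.
Proof. by rewrite /cochain free_extU !(tnth_nth None) /= inordK. Qed.

(** One condition for each of the four kinds of elements that span the
boundaries. *)
Record cocycle_mod (m : int) (w : option X0 -> option X0 -> int) : Prop := CocycleMod {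
  cocycle_diag : forall z, (m %| w z z)%Z;
  cocycle_edge : forall z, (m %| w (Some z) (Some (f z)))%Z;
  cocycle_base : forall y, (m %| w (Some y) None - w (Some (f y)) None)%Z;
  cocycle_step : forall y z,
    (m %| w (Some y) (Some z) - w (Some (f y)) (Some z) + w (Some (f z)) (Some z))%Z
}.

Lemma cocycle_mod_bounds m w : cocycle_mod m w ->
  forall c, bounds c -> (m %| cochain w c)%Z.
Proof.
move=> [wd we wb ws] _ [d ->]; pose G d := (m %| cochain w (@bd (fspindle f) 2 d))%Z.
apply: (@freeg_subgroup_ind (3.-tuple (fspindle f)) G) => [|t]; rewrite /G.
  split=> [|c c'] /=; first by rewrite !raddf0 dvdz0.
  by rewrite raddfB /= raddfB; exact: rpredB.
rewrite (tupleE3 t) bd_triple raddfD raddfB /= !cochain_pair.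
(* Only (b, y, b) needs two of the conditions at once. *)
case: (tnth t ord0) (tnth t (inord 1)) (tnth t (inord 2)) => [x|] [y|] [z|];
  rewrite /fop /= ?subrr ?add0r //.
by rewrite rpredD.
Qed.

(** * The generators generate *)

Variable V : set X0.
Hypothesis hV : one_per_orbit f V.
Local Notation gens := (gens f V).

Definition realize : {freeg gens} -> C1 := free_ext (fun g : gens => val g).

Lemma realize_is_zmod_morphism : zmod_morphism realize.
Proof. by move=> x y; exact: raddfB. Qed.

HB.instance Definition _ := GRing.isZmodMorphism.Build {freeg gens} C1
  realize realize_is_zmod_morphism.

Definition spanned (c : C1) : Prop := exists x, bounds (c - realize x).

Lemma spanned_subgroup : is_subgroup spanned.
Proof.
split=> [|c d [x hx] [y hy]].
  by exists 0; rewrite raddf0 subr0; exact: subgroup0 bounds_subgroup.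
exists (x - y); rewrite raddfB opprD addrACA -opprD.
exact: subgroupB bounds_subgroup _ _ hx hy.
Qed.

Lemma bounds_spanned c : bounds c -> spanned c.
Proof. by exists 0; rewrite raddf0 subr0. Qed.

Lemma gens_spanned c : gens c -> spanned c.
Proof.
move=> gc; exists << SigSub (mem_set gc) : gens >>.
rewrite /realize free_extU /= subrr; exact: subgroup0 bounds_subgroup.
Qed.

(** For z = f x the pairs (x, z) and (z, z) bound and differ by this tail up to a
boundary; for z initial it is a generator of type (1). *)
Lemma spanned_tail z : spanned (pair (Some (f z)) (Some z)).
Proof.
have [[x _ <-]|iz] := pselect (range f z); last first.
  by apply: gens_spanned; left; left; exists z.
have sb := bounds_subgroup; apply: bounds_spanned.
have := subgroupB sb (bounds_step x (f x)) (subgroupB sb (bounds_edge x) (bounds_diag (Some (f x)))).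
by rewrite addrC addKr.
Qed.

Lemma spanned_base y : spanned (pair (Some y) None).
Proof.
have P x : spanned (pair (Some x) None) <-> spanned (pair (Some (f x)) None).
  by apply: (subgroup_iff spanned_subgroup); exact/bounds_spanned/bounds_base_step.
have [v [[Vv yv] _]] := hV y; apply/(orbit_invariant P yv).
by apply: gens_spanned; left; right; left; exists v.
Qed.

(** Modulo boundaries and tails only the orbit of y matters, so y can be taken to
be z itself or the representative of an orbit that does not contain z. *)
Lemma spanned_pair y z : spanned (pair (Some y) (Some z)).
Proof.
have P x : spanned (pair (Some x) (Some z)) <-> spanned (pair (Some (f x)) (Some z)).
  apply: (subgroup_iff spanned_subgroup).
  rewrite -[_ - _](addrK (pair (Some (f z)) (Some z))).
  apply: (subgroupB spanned_subgroup _ (spanned_tail z)).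
  exact/bounds_spanned/bounds_step.
have [v [[Vv yv] _]] := hV y; apply/(orbit_invariant P yv).
have [vz|vz] := pselect (same_orbit v z).
  exact/(orbit_invariant P vz)/bounds_spanned/bounds_diag.
by apply: gens_spanned; left; right; right; exists v, z.
Qed.

(** Only the pairs (b, y) fail to be cycles, so a chain is studied through the
part of it that they carry. *)
Definition base_part : C1 -> {freeg X0} :=
  free_ext (fun t : 2.-tuple (fspindle f) =>
    if (tnth t ord0, tnth t (inord 1)) is (None, Some y) then << y >> else 0).

Definition from_base : {freeg X0} -> C1 := free_ext (fun y => pair None (Some y)).

Definition vertex_part : chain (fspindle f) 0 -> {freeg X0} :=
  free_ext (fun t : 1.-tuple (fspindle f) =>
    if tnth t ord0 is Some y then << y >> else 0).

Lemma base_part_is_zmod_morphism : zmod_morphism base_part.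
Proof. by move=> x y; exact: raddfB. Qed.

HB.instance Definition _ := GRing.isZmodMorphism.Build C1 {freeg X0}
  base_part base_part_is_zmod_morphism.

Lemma vertex_part_is_zmod_morphism : zmod_morphism vertex_part.
Proof. by move=> x y; exact: raddfB. Qed.

HB.instance Definition _ := GRing.isZmodMorphism.Build (chain (fspindle f) 0) {freeg X0}
  vertex_part vertex_part_is_zmod_morphism.

Lemma pair_ind (G : set C1) :
  is_subgroup G -> (forall x y, G (pair x y)) -> forall c, G c.
Proof.
move=> sG Gp; apply: (@freeg_subgroup_ind (2.-tuple (fspindle f)) G) => // t.
by rewrite (tupleE2 t); exact: Gp.
Qed.

Lemma base_part_pair x y :
  base_part (pair x y) = if (x, y) is (None, Some y) then << y >> else 0.
Proof. by rewrite /base_part free_extU !(tnth_nth None) /= inordK. Qed.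

(** The boundary of (b, y) is y - f y, and the other pairs have boundary 0. Hence
the base part of a cycle is fixed by the action of f. *)
Lemma bd_base_part (c : C1) :
  vertex_part (bd c) = base_part c - pushforward (base_part c).
Proof.
pose G c := vertex_part (@bd (fspindle f) 1 c) = base_part c - pushforward (base_part c).
apply: (@pair_ind G) => [|x y]; rewrite /G.
  split=> [|d e hd he]; first by rewrite /base_part /vertex_part !raddf0 addr0.
  rewrite (raddfB (@bd (fspindle f) 1)) (raddfB base_part) (raddfB pushforward) /=.
  by rewrite (raddfB vertex_part) /= hd he opprD addrACA -opprD.
rewrite bd_chain_pair (raddfB vertex_part) /= /vertex_part !free_extU !(tnth_nth None) base_part_pair.
by case: x y => [x|] [y|]; rewrite /= ?(raddf0 pushforward) ?subrr // /pushforward free_extU.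
Qed.

Lemma spanned_base_part (c : C1) : spanned (c - from_base (base_part c)).
Proof.
have sp := spanned_subgroup.
apply: (@pair_ind [set c | spanned (c - from_base (base_part c))]) => [|x y] /=.
  split=> [|d e hd he] /=; first by rewrite /from_base /base_part !raddf0 addr0; exact: subgroup0 sp.
  by rewrite (raddfB base_part) /= /from_base raddfB opprD addrACA -opprD; exact: subgroupB sp _ _ hd he.
rewrite base_part_pair; case: x y => [x|] [y|]; rewrite /from_base ?raddf0 ?subr0 ?addr0.
- exact: spanned_pair.
- exact: spanned_base.
- by rewrite free_extU subrr; exact: subgroup0.
- exact/bounds_spanned/bounds_diag.
Qed.

Lemma spanned_cycle c : bd c = 0 -> spanned c.
Proof.
move=> c0; apply/(subgroup_iff spanned_subgroup (spanned_base_part c)).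
have : pushforward (base_part c) = base_part c.
  by apply/esym/eqP; rewrite -subr_eq0 -bd_base_part c0 /vertex_part raddf0.
apply: (@invariant_cycle_sums [set u | spanned (from_base u)]) => [|s cs].
  split=> [|x y] /=; first by rewrite /from_base raddf0; exact: subgroup0 spanned_subgroup.
  by rewrite /from_base raddfB => hx hy; exact: subgroupB spanned_subgroup _ _ hx hy.
apply: gens_spanned; right; exists s => //.
by rewrite /from_base /cycle_sum raddf_sum /=; apply: eq_bigr => x _; rewrite free_extU.
Qed.

(** * Cochains dual to the generators *)

Lemma representative_unique x v w :
  V v -> V w -> same_orbit x v -> same_orbit x w -> v = w.
Proof.
move=> Vv Vw xv xw; have [u [_ uP]] := hV x.
by rewrite -(uP v) // -(uP w).
Qed.

(** If the forward paths of x and of its representative v meet after m and n steps,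
the height of x is n - m. Other choices of m and n change it by a multiple of
[ell f]. The normalization on V makes the height cochains vanish on the
generators of type (2). *)
Lemma height_exists : exists h : X0 -> int,
  (forall x, (ell f %| h (f x) - h x - 1)%Z) /\ (forall v, V v -> (ell f %| h v)%Z).
Proof.
have pos x : exists p : X0 * (nat * nat),
    V p.1 /\ iter p.2.1 f x = iter p.2.2 f p.1.
  have [v [[Vv /same_orbitP[m [n e]]] _]] := hV x.
  by exists (v, (m, n)).
have [p pP] := choice pos.
pose h x : int := (p x).2.2%:Z - (p x).2.1%:Z.
have rep x : same_orbit x (p x).1.
  by apply/same_orbitP; exists (p x).2.1, (p x).2.2; case: (pP x).
exists h; split=> [x|v Vv]; last first.
  have e : (p v).1 = v.
    by apply: representative_unique (rep v) (same_orbit_refl v); case: (pP v).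
  by have [_] := pP v; rewrite e => /esym; exact: collision_ell.
have [Vx ex] := pP x; have [Vfx efx] := pP (f x).
have e : (p (f x)).1 = (p x).1.
  by apply: (@representative_unique x) => //; apply/same_orbit_succl.
rewrite /h; move: efx ex; rewrite e; set m' := (p (f x)).2.1; set n' := (p (f x)).2.2.
set m := (p x).2.1; set n := (p x).2.2; set v := (p x).1; move=> e1 e2.
have : iter (m + n') f v = iter (m' + 1 + n) f v.
  by rewrite [LHS]iterD -e1 [RHS]iterD -e2 -iterSr -!iterD; congr (iter _ f x); lia.
move/collision_ell; congr (_ %| _)%Z; lia.
Qed.

(** With this convention the two families in [gens2] become one: pairs (v, z)
where z is b or a vertex outside the orbit of v. *)
Definition separated (v : X0) (z : option X0) : Prop :=
  if z is Some y then ~ same_orbit v y else True.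

Lemma gens2P c : gens2 f V c <-> exists v z, [/\ V v, separated v z & c = pair (Some v) z].
Proof.
split=> [[[v Vv <-]|[v [y [Vv vy ->]]]]|[v [[y|] [Vv vy ->]]]].
- by exists v, None.
- by exists v, (Some y).
- by right; exists v, y.
- by left; exists v.
Qed.

Lemma pair_inj x y x' y' : pair x y = pair x' y' -> x = x' /\ y = y'.
Proof.
move=> e; have := congr1 (@dom _ _) e; rewrite /chain_pair !domU1 => -[[-> ->]].
by [].
Qed.

(** The order of the class of a generator, 0 standing for infinite order. *)
Definition gen_order (c : C1) : nat := if `[< gens1 f c >] then ell f else 0.

(** The number of pairs that start with b tells generators of type (3) from the others. *)
Definition base_count (x y : option X0) : int := (x == None)%:R.

Lemma base_count_cycle c : cochain base_count (\sum_(x <- c) pair None (Some x)) = (size c)%:R.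
Proof.
rewrite raddf_sum /= (eq_bigr (fun=> 1)) => [|x _]; last by rewrite cochain_pair.
by rewrite big_const_seq count_predT iter_addr addr0.
Qed.

Lemma cycle_chain_neq_pair c x z :
  graph_cycle f c -> \sum_(x <- c) pair None (Some x) <> pair (Some x) z.
Proof.
move=> [c0 _ _] /(congr1 (cochain base_count)); rewrite base_count_cycle cochain_pair.
by rewrite /base_count /= => /eqP; rewrite pnatr_eq0 size_eq0; apply/negP.
Qed.

Lemma gens1_order c : gens1 f c -> gen_order c = ell f.
Proof. by move=> gc; rewrite /gen_order; case: asboolP. Qed.

Lemma gens2_order c : gens2 f V c -> gen_order c = 0%N.
Proof.
move=> /gens2P[v [z [Vv vz ->]]]; rewrite /gen_order; case: asboolP => // -[y _].
move=> /pair_inj[[e] ez]; move: vz; rewrite -ez -e => -[]; exact/same_orbit_succl/same_orbit_refl.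
Qed.

Lemma gens3_order c : gens3 f c -> gen_order c = 0%N.
Proof.
move=> [s cs <-]; rewrite /gen_order; case: asboolP => // -[y _] /esym.
by move/(cycle_chain_neq_pair cs).
Qed.

Definition dual_cocycle (c : C1) (w : option X0 -> option X0 -> int) : Prop :=
  cocycle_mod (gen_order c) w /\
  forall c', gens c' -> (gen_order c %| cochain w c' - (c' == c)%:R)%Z.

Lemma cochain_cycle0 w c : (forall x, w None (Some x) = 0) ->
  cochain w (\sum_(x <- c) pair None (Some x)) = 0.
Proof.
by move=> w0; rewrite raddf_sum /= big1 // => x _; rewrite cochain_pair w0.
Qed.

(** The cochain is the height of x relative to y on the pairs (x, y): the height
itself, shifted on the orbit of y so that y gets 0. It takes the value 1 on the
tail (f y, y), and the shift does not touch the pairs (v, y) of type (2). Edges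
(z, f z) cause no obstruction because y is initial. *)
Lemma gens1_dual c : gens1 f c -> exists w, dual_cocycle c w.
Proof.
move=> gc; rewrite /dual_cocycle (gens1_order gc); case: gc => y iy <- {c}.
have [h [hf hv]] := height_exists.
have fy z : f z = y -> False by move=> e; apply: iy; exists z.
pose w (x z : option X0) : int :=
  if (x, z) is (Some x', Some z') then
    if z' == y then h x' - (if `[< same_orbit x' y >] then h y else 0) else 0
  else 0.
have wyy : w (Some y) (Some y) = 0.
  by rewrite /w eqxx; case: asboolP => [_|[]]; rewrite ?subrr //; exact: same_orbit_refl.
have wfy : (ell f %| w (Some (f y)) (Some y) - 1)%Z.
  rewrite /w eqxx; case: asboolP => [_|[]]; first exact: hf.
  exact/same_orbit_succl/same_orbit_refl.
exists w; split.
  split=> [[z|]|z|x|x z] //; rewrite /w.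
  - by case: (z =P y) => [->|//]; have := wyy; rewrite /w eqxx => ->.
  - by case: (f z =P y) => [/fy|].
  - case: (z =P y) => [->|_]; last exact: dvdz0.
    have := wfy; rewrite /w !eqxx => wfy'.
    have -> : `[< same_orbit (f x) y >] = `[< same_orbit x y >].
      by apply/asbool_equiv_eq/same_orbit_succl.
    by have := rpredB wfy' (hf x); congr (_ %| _)%Z; ring.
move=> _ [[[y' _ <-]|/gens2P[v [z [Vv vz ->]]]]|[s cs <-]].
- rewrite cochain_pair; have [->|ne] := eqVneq y' y; first by rewrite eqxx.
  rewrite (_ : (_ == _) = false) ?subr0; first by rewrite /w (negbTE ne) dvdz0.
  by apply/eqP => /pair_inj[_ [e]]; case/eqP: ne.
- rewrite cochain_pair (_ : (_ == _) = false) ?subr0.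
    case: z vz => [z|] vz; rewrite /w ?dvdz0 //; case: (z =P y) vz => [->|_] vz; last exact: dvdz0.
    by rewrite asboolF // subr0; exact: hv.
  apply/eqP => /pair_inj[[e] ez]; move: vz; rewrite ez e => -[].
  exact/same_orbit_succl/same_orbit_refl.
- rewrite cochain_cycle0 // (_ : (_ == _) = false) ?subr0 ?dvdz0 //.
  exact/eqP/(cycle_chain_neq_pair cs).
Qed.

(** The cochain counts the pairs (x, z) with x in the orbit of v. Tails and edges
join vertices of one orbit, and z is not in that of v, so they are not
counted. *)
Lemma gens2_dual c : gens2 f V c -> exists w, dual_cocycle c w.
Proof.
move=> gc; rewrite /dual_cocycle (gens2_order gc); case/gens2P: gc => v [z [Vv vz ->]] {c}.
pose w (x z' : option X0) : int :=
  if x is Some x' then ((z' == z) && `[< same_orbit x' v >])%:R else 0.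
have wE x x' : same_orbit x' x -> `[< same_orbit x' v >] = `[< same_orbit x v >].
  move=> xx'; apply/asbool_equiv_eq; split; apply: same_orbit_trans => //.
  exact: same_orbit_sym.
have w0 y x : same_orbit x y -> w (Some x) (Some y) = 0.
  move=> xy; rewrite /w; case: eqP vz => [<- /= vy|//].
  rewrite asboolF // => xv; apply: vy; exact: same_orbit_trans (same_orbit_sym xv) xy.
exists w; split.
  split=> [[y|]|y|x|x y] //.
  - by rewrite w0 //; exact: same_orbit_refl.
  - by rewrite w0 //; exact: same_orbit_succ.
  - by rewrite /w (wE (f x)) ?subrr //; exact: same_orbit_succ.
  - rewrite [X in _ + X]w0; last exact/same_orbit_succl/same_orbit_refl.
    by rewrite /w (wE (f x)) ?subrr //; exact: same_orbit_succ.
move=> _ [[[y _ <-]|/gens2P[u [y [Vu uy ->]]]]|[s cs <-]].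
- rewrite cochain_pair w0; last exact/same_orbit_succl/same_orbit_refl.
  rewrite (_ : (_ == _) = false) ?subr0 //.
  apply/eqP => /pair_inj[[e] ez]; move: vz; rewrite -ez -e => -[].
  exact/same_orbit_succl/same_orbit_refl.
- rewrite cochain_pair /w (_ : (_ == pair _ _) = (y == z) && `[< same_orbit u v >]) ?subrr //.
  apply/eqP/andP => [/pair_inj[[->] ->]|[/eqP -> /asboolP uv]].
    by split=> //; apply/asboolP; exact: same_orbit_refl.
  by rewrite (representative_unique Vu Vv (same_orbit_refl u) uv).
- rewrite cochain_cycle0 // (_ : (_ == _) = false) ?subr0 ?dvdz0 //.
  exact/eqP/(cycle_chain_neq_pair cs).
Qed.

Definition vertex_cochain (x : X0) (a b : option X0) : int :=
  if a is Some _ then 0 else (b == Some x)%:R.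

Lemma cochain_vertex_cycle x s : graph_cycle f s ->
  cochain (vertex_cochain x) (\sum_(y <- s) pair None (Some y)) = (x \in s)%:R.
Proof.
move=> [_ us _]; rewrite -coeff_cycle_sum // /cycle_sum !raddf_sum.
by apply: eq_bigr => y _; rewrite /= cochain_pair coeffU mul1r.
Qed.

Lemma cycle_chain_mem s t : graph_cycle f s -> graph_cycle f t ->
  \sum_(y <- s) pair None (Some y) = \sum_(y <- t) pair None (Some y) -> s =i t.
Proof.
move=> cs ct e x; have := congr1 (cochain (vertex_cochain x)) e.
by rewrite !cochain_vertex_cycle //; do 2 case: (x \in _).
Qed.

(** No boundary involves a pair (b, y), so counting the pairs (b, x) for one
vertex x of the cycle is a cocycle. *)
Lemma gens3_dual c : gens3 f c -> exists w, dual_cocycle c w.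
Proof.
move=> gc; rewrite /dual_cocycle (gens3_order gc); case: gc => s cs <- {c}.
have [x xs] : exists x, x \in s.
  by case: cs => + _ _; case: s => // x s _; exists x; exact: mem_head.
pose w := vertex_cochain x.
exists w; split; first by split=> [[z|]|z|y|y z].
move=> _ [[[y _ <-]|/gens2P[u [y [Vu uy ->]]]]|[t ct <-]].
- rewrite cochain_pair (_ : (_ == _) = false) ?subr0 //.
  by apply/eqP => /esym; exact: cycle_chain_neq_pair cs.
- rewrite cochain_pair (_ : (_ == _) = false) ?subr0 //.
  by apply/eqP => /esym; exact: cycle_chain_neq_pair cs.
- rewrite cochain_vertex_cycle // (_ : (_ == _) = (x \in t)) ?subrr //.
  apply/eqP/idP => [/(cycle_chain_mem ct cs) ->//|xt].
  exact/perm_big/(graph_cycle_perm ct cs xt xs).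
Qed.

Lemma gens_dual c : gens c -> exists w, dual_cocycle c w.
Proof. by case=> [[/gens1_dual|/gens2_dual]|/gens3_dual]. Qed.

(** * The presentation *)

Lemma bounds_coeff x : bounds (realize x) -> forall g : gens, (gen_order (val g) %| coeff g x)%Z.
Proof.
move=> bx g; have [w [cw dw]] := gens_dual (set_mem (valP g)).
have := cocycle_mod_bounds cw bx; rewrite /realize free_ext_comp => h.
have H j : (gen_order (val g) %| cochain w (val j) - (j == g)%:R)%Z.
  by have := dw _ (set_mem (valP j)); rewrite (inj_eq val_inj).
by have := rpredB h (dvdz_coeff H x); rewrite subKr.
Qed.

Lemma subgroup_generated_subgroup (A : zmodType) (S : set A) :
  is_subgroup (subgroup_generated S).
Proof.
by split=> [G _|y z hy hz G SG G0 GB]; [|apply: (GB); [exact: hy|exact: hz]].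
Qed.

Lemma coeff_gen_rels x : (forall g : gens, (gen_order (val g) %| coeff g x)%Z) ->
  subgroup_generated (gen_rels f V) x.
Proof.
have sR := subgroup_generated_subgroup (gen_rels f V).
move=> hx; rewrite -(freeg_sumE x); apply: (subgroup_sum sR) => g _.
have /dvdzP[q ->] := hx g; rewrite /gen_order; case: asboolP => [g1|_]; last first.
  by rewrite mulr0 freegU0; exact: subgroup0 sR.
rewrite (_ : << _ *g g >> = << g >> *+ ell f *~ q); last first.
  by rewrite freegU_muln freeg_mulz -mulrzr intz mulrC natz.
by apply: (subgroupMz sR) => G SG _ _; apply: SG; exists g.
Qed.

Lemma gen_rels_bounds x : subgroup_generated (gen_rels f V) x -> bounds (realize x).
Proof.
have sb := bounds_subgroup.
move=> /(_ [set x | bounds (realize x)]); apply => /=.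
- move=> _ [g [y _ gE] <-]; rewrite /mkset (raddfMn realize) /= /realize free_extU -gE; exact: bounds_ell.
- by rewrite raddf0; exact: subgroup0.
- by move=> y z hy hz; rewrite raddfB; exact: subgroupB sb _ _ hy hz.
Qed.

Local Notation H1 := (homology (fspindle f) 1).
Local Notation cycle1 := (chain_cycle (fspindle f) 1).

Lemma homology_class_is_zmod_morphism : zmod_morphism (@homology_class (fspindle f) 1).
Proof. by move=> x y; rewrite /homology_class raddfB. Qed.

HB.instance Definition _ := GRing.isZmodMorphism.Build cycle1 H1
  (@homology_class (fspindle f) 1) homology_class_is_zmod_morphism.

Lemma homology_class_eq0 (z : cycle1) : homology_class z = 0 <-> bounds (cycle_val z).
Proof.
rewrite /homology_class -(raddf0 (\pi_H1)%qT).
split=> [/eqP|[d zd]].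
  by rewrite -Quotient.idealrBE subr0 unfold_in => /asboolP[d zd]; exists d.
by apply/eqP; rewrite -Quotient.idealrBE subr0 unfold_in; apply/asboolP; exists d.
Qed.

Definition gen_class : {freeg gens} -> H1 :=
  free_ext (fun g : gens => homology_class (gen_cycle g)).

Lemma gen_classE x : gen_class x = homology_class (free_ext (@gen_cycle _ f V) x).
Proof. by rewrite free_ext_comp. Qed.

Lemma cycle_val_free_ext x : cycle_val (free_ext (@gen_cycle _ f V) x) = realize x.
Proof. exact: (free_ext_comp (val : {additive cycle1 -> C1})). Qed.

Lemma gen_class_eq0 x : gen_class x = 0 <-> bounds (realize x).
Proof. by rewrite gen_classE homology_class_eq0 cycle_val_free_ext. Qed.

Lemma gen_class_surj a : exists x, gen_class x = a.
Proof.
pose z := (repr a : cycle1).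
have [x zx] : spanned (cycle_val z) by apply: spanned_cycle; apply/eqP; exact: (cycle_valP z).
exists x; apply/eqP; rewrite eq_sym -subr_eq0; apply/eqP.
rewrite gen_classE -[a]reprK -/(homology_class z) -(raddfB (@homology_class (fspindle f) 1)).
apply/homology_class_eq0.
have -> u v : cycle_val (u - v : cycle1) = cycle_val u - cycle_val v.
  exact: (raddfB (val : {additive cycle1 -> C1})).
by rewrite cycle_val_free_ext.
Qed.

(** Dual cochains show that boundaries have these coefficients; conversely such a
combination follows from the relations, which hold up to boundaries. *)
Lemma gen_class_kernel x : gen_class x = 0 <->
  forall g : gens, (gen_order (val g) %| coeff g x)%Z.
Proof.
rewrite gen_class_eq0; split; first exact: bounds_coeff.
by move/coeff_gen_rels/gen_rels_bounds.
Qed.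

Lemma gens_presentation : presented_by
  (fun g : gens => homology_class (gen_cycle g) : H1) (gen_rels f V).
Proof.
split=> [a|x]; first exact: gen_class_surj.
rewrite -/(gen_class x) gen_class_eq0; split; last exact: gen_rels_bounds.
by move/bounds_coeff/coeff_gen_rels.
Qed.

(** * Counting the generators of a finite f-spindle *)

Section Finite.
Hypothesis finX : finite_set [set: fspindle f].

Lemma finite_enum (A : set X0) :
  exists s : seq X0, uniq s /\ forall x, x \in s <-> A x.
Proof.
have [S SE] := (finite_seqP _).1 finX.
have XS (x : X0) : Some x \in S.
  by have : [set: fspindle f] (Some x) by []; rewrite SE.
exists (undup [seq x <- pmap id S | `[< A x >]]); split=> [|x]; first exact: undup_uniq.
rewrite mem_undup mem_filter; split=> [/andP[/asboolP]//|Ax].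
by apply/andP; split; [apply/asboolP | rewrite mem_pmap map_id].
Qed.

Lemma orbit_cycle x : exists c, graph_cycle f c /\ forall y, y \in c -> same_orbit x y.
Proof.
have [s [us sP]] := finite_enum setT.
have : looping f x (size s).
  apply: contraT; rewrite -looping_uniq => /uniq_leq_size H.
  have : (size (traject f x (size s).+1) <= size s)%N by apply: H => z _; apply/sP.
  by rewrite size_traject ltnn.
case/trajectP=> i iS e; have k_gt0 : (0 < size s - i)%N by rewrite subn_gt0.
have [|c [cc xc _]] := @periodic_cycle (iter i f x) (size s - i) k_gt0.
  by rewrite -iterD subnK // ltnW.
exists c; split=> // y yc; have [_ _ fc] := cc; have [k ->] := fcycle_reach fc xc yc.
by rewrite -iterD; exact: same_orbit_iter.
Qed.

(** A cycle is closed under f, so forward paths that meet put both cycles through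
one vertex. *)
Lemma orbit_cycle_unique s t x y : graph_cycle f s -> graph_cycle f t ->
  x \in s -> y \in t -> same_orbit x y -> perm_eq s t.
Proof.
move=> cs ct xs yt /same_orbitP[m [n e]]; have [[_ _ fs] [_ _ ft]] := (cs, ct).
apply: (@graph_cycle_perm _ _ (iter m f x)) => //; first exact: fcycle_iter.
by rewrite e; exact: fcycle_iter.
Qed.

Lemma num_orbits (s : seq X0) : uniq s -> (forall x, x \in s <-> V x) -> orb f = size s.
Proof.
move=> us sV; rewrite -(size_map same_orbit); apply: num_seq => [|O].
  rewrite map_inj_in_uniq // => v w /sV Vv /sV Vw e.
  by apply: (representative_unique Vv Vw (same_orbit_refl v)); rewrite e; exact: same_orbit_refl.
split=> [/mapP[v _ ->]|[x _ <-]]; first by exists v.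
have [v [[/sV vs xv] _]] := hV x; apply/mapP; exists v => //.
apply/funext => y; apply/propext; split; apply: same_orbit_trans => //.
exact: same_orbit_sym.
Qed.

Lemma gens1_enum : exists s : seq C1,
  [/\ uniq s, size s = init f & forall c, c \in s <-> gens1 f c].
Proof.
have [s [us sI]] := finite_enum (initial f).
exists [seq pair (Some (f y)) (Some y) | y <- s]; split=> [||c].
- by rewrite map_inj_uniq // => y z /pair_inj[_ []].
- by rewrite size_map; apply/esym/num_seq.
- by split=> [/mapP[y /sI iy ->]|[y /sI ys <-]]; [exists y | exact: map_f].
Qed.

(** For z = b all representatives v are allowed, and for z in X0 all but that of
the orbit of z. *)
Lemma gens2_enum : exists s : seq C1,
  [/\ uniq s, size s = (orb f + num [set: X0] * (orb f - 1))%N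
    & forall c, c \in s <-> gens2 f V c].
Proof.
have [sV [uV sVP]] := finite_enum V; have [sX [uX sXP]] := finite_enum setT.
pose zs : seq (option X0) := None :: [seq Some y | y <- sX].
pose vs z := [seq v <- sV | `[< separated v z >]].
have sz_vs y : size (vs (Some y)) = (orb f - 1)%N.
  have [v [[Vv yv] vP]] := hV y; rewrite (num_orbits uV sVP) size_filter.
  rewrite -(count_predC (pred1 v)) -/(count_mem v sV) count_uniq_mem //.
  have /sVP -> := Vv; rewrite add1n subn1 /=; apply: eq_in_count => u /sVP Vu /=.
  apply/asboolP/negP => [uy /eqP e|uv yu].
    by apply: uy; rewrite e; exact: same_orbit_sym.
  by apply: uv; apply/eqP/esym/vP; split=> //; exact: same_orbit_sym.
exists [seq pair (Some v) z | z <- zs, v <- vs z]; split=> [||c].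
- apply: allpairs_uniq_dep => [|z _|].
  + rewrite /= map_inj_uniq ?uX ?andbT; last by move=> ? ? [].
    by apply/mapP => -[].
  + exact: filter_uniq.
  + by move=> [z v] [z' v'] _ _ /= /pair_inj[[->] ->].
- rewrite size_allpairs_dep /= -map_comp; congr (_ + _)%N.
    rewrite (num_orbits uV sVP) size_filter; apply/eqP; rewrite -all_count.
    by apply/allP => v _; apply/asboolP.
  rewrite (eq_map (g := fun=> (orb f - 1)%N)) => [|y]; last exact: sz_vs.
  by rewrite sumnE big_map big_const_seq count_predT iter_addn_0 mulnC (num_seq uX sXP).
- split=> [/allpairsPdep[z [v [_ + ->]]]|/gens2P[v [z [Vv vz ->]]]].
    rewrite mem_filter => /andP[/asboolP vz /sVP Vv].
    by apply/gens2P; exists v, z.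
  apply/allpairsPdep; exists z, v; split=> //.
    by case: z {vz} => [y|]; rewrite inE // map_f //; exact/sXP.
  by rewrite mem_filter; apply/andP; split; [exact/asboolP | exact/sVP].
Qed.

(** By finiteness every orbit contains a cycle, and only one. *)
Lemma gens3_enum : exists s : seq C1,
  [/\ uniq s, size s = orb f & forall c, c \in s <-> gens3 f c].
Proof.
have [sV [uV sVP]] := finite_enum V; have [cyc cycP] := choice orbit_cycle.
exists [seq \sum_(x <- cyc v) pair None (Some x) | v <- sV]; split=> [||c].
- rewrite map_inj_in_uniq // => v w /sVP Vv /sVP Vw e.
  have [[cv vO] [cw wO]] := (cycP v, cycP w).
  have [x xv] : exists x, x \in cyc v.
    by case: cv => + _ _; case: (cyc v) => // x t _; exists x; exact: mem_head.
  apply: (representative_unique Vv Vw (x := x)); apply: same_orbit_sym; first exact: vO.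
  by apply: wO; rewrite -(cycle_chain_mem cv cw e).
- by rewrite size_map -(num_orbits uV sVP).
- split=> [/mapP[v _ ->]|[s cs <-]]; first by exists (cyc v) => //; case: (cycP v).
  have [x xs] : exists x, x \in s.
    by case: cs => + _ _; case: (s) => // x t _; exists x; exact: mem_head.
  have [v [[/sVP vs xv] _]] := hV x; apply/mapP; exists v => //.
  have [cv vO] := cycP v; have [y yv] : exists y, y \in cyc v.
    by case: cv => + _ _; case: (cyc v) => // y t _; exists y; exact: mem_head.
  apply: perm_big; apply: (orbit_cycle_unique cs cv xs yv).
  exact: same_orbit_trans xv (vO _ yv).
Qed.

Lemma gens_enum (S : set C1) (s : seq C1) : uniq s -> (forall c, c \in s <-> S c) ->
  S `<=` gens -> exists e : 'I_(size s) -> gens,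
    [/\ injective e, forall i, S (val (e i)) & forall g : gens, S (val g) -> exists i, g = e i].
Proof.
move=> us sS Sg; have Ss (i : 'I_(size s)) : S (tnth (in_tuple s) i) by apply/sS/mem_tnth.
exists (fun i => SigSub (mem_set (Sg _ (Ss i))) : gens); split=> [i j|i|g /sS].
- by move=> /(congr1 val) /=; move: i j; apply/tuple_uniqP.
- exact: Ss.
- move=> /(tnthP (in_tuple s))[i gi]; exists i; exact: val_inj.
Qed.

Lemma homology_finite : isomorphic H1
  ('rV[int]_(num [set: X0] * (orb f - 1) + 2 * orb f)%N * 'rV[Zmod (ell f)]_(init f))%type.
Proof.
have [s1 [us1 <- s1P]] := gens1_enum.
have [s2 [us2 sz2 s2P]] := gens2_enum; have [s3 [us3 sz3 s3P]] := gens3_enum.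
have -> : (num [set: X0] * (orb f - 1) + 2 * orb f)%N = size (s2 ++ s3).
  by rewrite size_cat sz2 sz3; lia.
have us23 : uniq (s2 ++ s3).
  rewrite cat_uniq us2 us3 andbT; apply/hasPn => c /s3P[t ct <-]; apply/negP.
  by move=> /s2P/gens2P[v [z [_ _]]]; exact: cycle_chain_neq_pair.
have s23P c : c \in s2 ++ s3 <-> (gens2 f V `|` gens3 f) c.
  rewrite mem_cat; split=> [/orP[/s2P|/s3P]|[/s2P ->//|/s3P ->]]; [by left | by right |].
  by rewrite orbT.
have [|d [dinj dS dcov]] := gens_enum us1 s1P; first by move=> c; left; left.
have [|e [einj eS ecov]] := gens_enum us23 s23P.
  by move=> c [|]; [left; right | right].
pose m := GRing.isZmodMorphism.Build {freeg gens} H1 gen_class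
  (fun x y => raddfB _ x y : gen_class (x - y) = gen_class x - gen_class y).
pose q : {additive {freeg gens} -> H1} := HB.pack gen_class m.
apply: (@isomorphic_coeff_quotient _ _ q (fun g => gen_order (val g)) _ _ _ e d) => //.
- exact: gen_class_surj.
- exact: gen_class_kernel.
- move=> i j; apply/eqP => ij; have := eS i; have := dS j; rewrite -ij => -[y _ <-].
  case=> [/gens2P[v [z [_ vz /pair_inj[[fyv] yz]]]]|[t ct /(cycle_chain_neq_pair ct)]] //.
  by move: vz; rewrite -fyv -yz => -[]; exact/same_orbit_succl/same_orbit_refl.
- move=> g; case: (set_mem (valP g)) => [[g1|g2]|g3]; [right|left|left].
  + exact: dcov.
  + by apply: ecov; left.
  + by apply: ecov; right.
- by move=> i; case: (eS i) => [/gens2_order|/gens3_order].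
- by move=> j; exact: gens1_order.
Qed.

End Finite.
End FSpindleHomology.

Theorem theorem3p4 (X0 : choiceType) (f : X0 -> X0) (V : set X0)
    (hV : one_per_orbit f V) :
  presented_by
    (fun g : gens f V => homology_class (gen_cycle g) : homology (fspindle f) 1)
    (gen_rels f V)
  /\
  (finite_set [set: fspindle f] ->
   isomorphic (homology (fspindle f) 1)
     ('rV[int]_(num [set: X0] * (orb f - 1) + 2 * orb f)%N
      * 'rV[Zmod (ell f)]_(init f))%type).
Proof.
by split=> [|finX]; [exact: gens_presentation | exact: homology_finite hV finX].
Qed.
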